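(* Let $R$ be a finite field with the discrete topology, let $\Gamma$ be a set with at least two elements, let $\varphi:\Gamma\to\Gamma$ be an arbitrary map and let $\mathfrak{w}=(\mathfrak{w}_\alpha)_{\alpha\in\Gamma}\in R^\Gamma$. Let $\sigma_{\varphi,\mathfrak{w}}:R^\Gamma\to R^\Gamma$ be the weighted generalized shift $\sigma_{\varphi,\mathfrak{w}}((x_\alpha)_{\alpha\in\Gamma})=(\mathfrak{w}_\alpha x_{\varphi(\alpha)})_{\alpha\in\Gamma}$. Then the following statements are equivalent: (1) $(R^\Gamma,\sigma_{\varphi,\mathfrak{w}})$ is sensitive; (1') $(R^\Gamma,\sigma_{\varphi,\mathfrak{w}})$ is strongly sensitive; (2) there exists a non-quasi-periodic point $\theta\in\Gamma$ of $\varphi$ such that $\mathfrak{w}_{\varphi^n(\theta)}\neq 0$ for all $n\geq 0$; (3) $(R^\Gamma,\sigma_{\varphi,\mathfrak{w}})$ has at least one scrambled pair; (4) $(R^\Gamma,\sigma_{\varphi,\mathfrak{w}})$ is Li--Yorke chaotic.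
   Context: $R^\Gamma$ carries the product topology; it is compact Hausdorff, and its unique compatible uniform structure is $\mathcal{K}=\{\mathcal{O}\subseteq R^\Gamma\times R^\Gamma:$ there is a finite $M\subseteq\Gamma$ with $\mathcal{O}_M\subseteq\mathcal{O}\}$, where $\mathcal{O}_M=\{(x,y)\in R^\Gamma\times R^\Gamma: x_\alpha=y_\alpha \text{ for all }\alpha\in M\}$. A point $a$ of a set $A$ is quasi-periodic for a self-map $h:A\to A$ if there exist $i>j\geq 1$ with $h^i(a)=h^j(a)$; otherwise it is non-quasi-periodic (equivalently $\{h^n(a):n\ge1\}$ is infinite). Let $X$ be a compact Hausdorff space with its unique compatible uniform structure $\mathcal{F}$, and $f:X\to X$ continuous. - $(X,f)$ is sensitive if there exists $\mathcal{O}\in\mathcal{F}$ such that for every $x\in X$ and every open neighbourhood $U$ of $x$ there exist $y\in U$ and $n\geq 0$ with $(f^n(x),f^n(y))\notin\mathcal{O}$. - $(X,f)$ is strongly sensitive if there exists $\mathcal{O}\in\mathcal{F}$ such that for every $x\in X$ and every open neighbourhood $U$ of $x$ there exist $y\in U$ and $N\geq 0$ with $(f^n(x),f^n(y))\notin\mathcal{O}$ for all $n\geq N$. - $x,y\in X$ are proximal if for each $\mathcal{O}\in\mathcal{F}$ the set $\{n\geq 1:(f^n(x),f^n(y))\in\mathcal{O}\}$ is nonempty (equivalently, for each $\mathcal{O}\in\mathcal{F}$ it is infinite). - $x,y\in X$ are asymptotic if for each $\mathcal{O}\in\mathcal{F}$ there is $N\geq 1$ with $(f^n(x),f^n(y))\in\mathcal{O}$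 for all $n\geq N$. - $x,y\in X$ are scrambled (form a scrambled pair) if they are proximal and not asymptotic. A subset $A\subseteq X$ with at least two elements is scrambled if all distinct $z,w\in A$ are scrambled. - $(X,f)$ is Li--Yorke chaotic if it has an uncountable scrambled subset. *)

(* Defs.v *)
From HB Require Import structures.
From mathcomp Require Import all_boot all_algebra finmap.
From mathcomp Require Import all_classical topology.

Set Implicit Arguments.
Unset Strict Implicit.
Unset Printing Implicit Defensive.

Import GRing.Theory.
Local Open Scope classical_set_scope.
Local Open Scope ring_scope.

Definition quasi_periodic (A : Type) (h : A -> A) (a : A) : Prop :=
  exists i j : nat, [/\ (1 <= j)%N, (j < i)%N & iter i h a = iter j h a].

Definition sensitive (X : uniformType) (f : X -> X) : Prop :=
  exists2 O : set (X * X), entourage O &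
    forall (x : X) (U : set X), open U -> U x ->
      exists (y : X) (n : nat), U y /\ ~ O (iter n f x, iter n f y).

Definition strongly_sensitive (X : uniformType) (f : X -> X) : Prop :=
  exists2 O : set (X * X), entourage O &
    forall (x : X) (U : set X), open U -> U x ->
      exists (y : X) (N : nat), U y /\
        forall n : nat, (N <= n)%N -> ~ O (iter n f x, iter n f y).

Definition proximal (X : uniformType) (f : X -> X) (x y : X) : Prop :=
  forall O : set (X * X), entourage O ->
    exists2 n : nat, (1 <= n)%N & O (iter n f x, iter n f y).

Definition asymptotic (X : uniformType) (f : X -> X) (x y : X) : Prop :=
  forall O : set (X * X), entourage O ->
    exists2 N : nat, (1 <= N)%N &
      forall n : nat, (N <= n)%N -> O (iter n f x, iter n f y).

Definition scrambled_pair (X : uniformType) (f : X -> X) (x y : X) : Prop :=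
  proximal f x y /\ ~ asymptotic f x y.

Definition scrambled_set (X : uniformType) (f : X -> X) (A : set X) : Prop :=
  (exists z w : X, [/\ A z, A w & z <> w]) /\
  forall z w : X, A z -> A w -> z <> w -> scrambled_pair f z w.

Definition li_yorke_chaotic (X : uniformType) (f : X -> X) : Prop :=
  exists2 A : set X, ~ countable A & scrambled_set f A.

(* The alias [discrete_topology] puts the discrete topology and uniformity on
   R; it is convertible to R, so that the field operations still apply. *)
Notation power_space R Gamma := {ptws Gamma -> discrete_topology R}.

Definition weighted_shift (R : finFieldType) (Gamma : Type)
    (phi : Gamma -> Gamma) (w : Gamma -> R)
    (x : power_space R Gamma) : power_space R Gamma :=
  fun alpha => w alpha * (x (phi alpha) : R).

(* The uniformity used by the definitions above on R^Gamma: it is generated by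
   the relations of equality on finitely many coordinates. *)
Lemma entourage_power_spaceE (R : finFieldType) (Gamma : Type)
    (O : set (power_space R Gamma * power_space R Gamma)) :
  entourage O <->
  exists2 M : set Gamma, finite_set M &
    forall x y : power_space R Gamma,
      (forall alpha, M alpha -> x alpha = y alpha) -> O (x, y).
Proof.
split.
- move=> [_ [D _ <-] DO]; exists [set (sval p).1 | p in [set` D]].
    exact/finite_image/finite_fset.
  move=> x y xyM; apply: DO => p Dp.
  have /asboolP [V /= entV] := projT2 p; apply.
  have /= xyp : x (sval p).1 = y (sval p).1 by apply: xyM; exists p.
  suff : V (x (sval p).1, y (sval p).1) by [].
  rewrite xyp; exact: entourage_refl.
- move=> [M /(@finite_fsetP {classic Gamma}) [D ->] MO].
  pose P (alpha : {classic Gamma}) : set (power_space R Gamma * power_space R Gamma) :=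
    [set xy | xy.1 alpha = xy.2 alpha].
  have entP alpha : entourage (P alpha).
    have eP : `[< @entourage (initial_topology (@proj _ (fun=> discrete_topology R) alpha)) (P alpha) >].
      apply/asboolP; exists [set xy | xy.1 = xy.2] => //.
      by rewrite uniform_discrete => _ [r _ <-].
    exists (P alpha) => //.
    exact: (@finI_from1 _ _ setT (fun p => (sval p).2)
      (exist (fun p : _ * _ => `[< @entourage (initial_topology
        (@proj _ (fun=> discrete_topology R) p.1)) p.2 >]) (alpha, P alpha) eP)).
  apply: (@filterS _ entourage _ (\bigcap_(alpha in [set` D]) P alpha)).
    by move=> [x y] xyD; apply: MO => alpha /xyD.
  exact: filter_bigI.
Qed.

Lemma compact_power_space (R : finFieldType) (Gamma : Type) :
  compact [set: power_space R Gamma].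
Proof.
have := @tychonoff {classic Gamma} (fun=> discrete_topology R) (fun=> setT).
rewrite (_ : [set f | _] = setT); last by apply/seteqP; split.
apply=> _; apply: finite_compact; exact: (@finite_finset R).
Qed.

Lemma hausdorff_power_space (R : finFieldType) (Gamma : Type) :
  hausdorff_space (power_space R Gamma).
Proof.
apply: (@hausdorff_product {classic Gamma} (fun=> discrete_topology R)) => _.
exact: discrete_hausdorff.
Qed.

Lemma weighted_shift_continuous (R : finFieldType) (Gamma : Type)
    (phi : Gamma -> Gamma) (w : Gamma -> R) :
  continuous (weighted_shift phi w).
Proof.
have xF (x : power_space R Gamma) : Filter (nbhs x) by exact: nbhs_filter.
move=> x; apply/cvg_entourageP => O /entourage_power_spaceE [M Mfin MO].
have : entourage [set yz : power_space R Gamma * power_space R Gamma |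
    O (weighted_shift phi w yz.1, weighted_shift phi w yz.2)].
  apply/entourage_power_spaceE; exists (phi @` M); first exact: finite_image.
  move=> y z yz; apply: MO => alpha Malpha.
  by congr (w alpha * _); apply: yz; exists alpha.
move=> /(nbhs_entourage x); apply: (@filterS _ (nbhs x)) => y /xsectionP.
exact.
Qed.

(* Main.v *)
Require Import Defs.
From HB Require Import structures.
From mathcomp Require Import all_boot all_algebra finmap.
From mathcomp Require Import all_classical topology.
From mathcomp Require Import zify.

Set Implicit Arguments.
Unset Strict Implicit.
Unset Printing Implicit Defensive.

Import GRing.Theory.

Local Open Scope classical_set_scope.
Local Open Scope ring_scope.

(* The n-th iterate of the shift reads, at a coordinate a, the entry at
   phi^n(a) multiplied by the weights met at a, ..., phi^(n-1)(a).
   If every orbit is finite or meets a zero weight, finitely many entries of x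
   therefore determine all values at a: the iterates are uniformly
   equicontinuous, so the shift is not sensitive and proximal pairs are
   asymptotic.
   Conversely, along an infinite orbit of theta with nonzero weights, altering x
   on the tail of that orbit is visible at theta at all late times.  Points
   supported on the sparse set of all phi^(2^k)(theta) are pairwise proximal,
   because a window of fixed size around 3 * 2^k misses this set for large k,
   and two of them that differ at infinitely many k are not asymptotic. *)

(** * Orbits of a self-map, and Cantor's diagonal argument *)

Lemma finite_set_nat_ltn (A : set nat) :
  finite_set A -> exists N, forall n, A n -> (n < N)%N.
Proof.
move=> /finite_fsetP[D ->]; exists (\max_(i <- D) i).+1 => n /= Dn.
by rewrite ltnS; apply: leq_bigmax_seq.
Qed.

Lemma iter_quasi_periodic (A : Type) (h : A -> A) (a : A) :
  quasi_periodic h a ->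
  exists K, forall n, exists2 k, (k < K)%N & iter n h a = iter k h a.
Proof.
move=> [i [j [_ ji hij]]]; exists i; elim/ltn_ind => n IH.
case: (ltnP n i) => ni; first by exists n.
(* Lowering the exponent by [i - j] keeps the point, and [j < i] makes the new exponent smaller than
   [n]. *)
have [k ki hk] := IH (n - i + j)%N ltac:(lia); exists k => //.
by rewrite -hk -{1}(subnK ni) !iterD hij.
Qed.

Lemma iter_inj_non_quasi_periodic (A : Type) (h : A -> A) (a : A) :
  ~ quasi_periodic h a -> injective (fun n => iter n h a).
Proof.
move=> nqp m n /= mn; apply/eqP/negPn/negP => mDn; apply: nqp.
wlog nm : m n mn mDn / (n < m)%N => [wlog_nm|].
  by move: (mDn); rewrite neq_ltn => /orP[lt|lt];
     [apply: (wlog_nm n m)|exact: (wlog_nm m n)]; rewrite // eq_sym.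
(* [quasi_periodic] wants exponents at least 1, while [n] may be 0: the coincidence is moved one
   step on. *)
by exists m.+1, n.+1; split => //=; rewrite mn.
Qed.

(** One meeting [h^i(a) = h^l(b)] fixes the offset of all later ones: the orbits then run together,
    and injectivity forces [m - n = l - i]. The bound [D = i + l] also ensures [i <= n]. *)
Lemma iter_meet_window (A : Type) (h : A -> A) (a b : A) :
  injective (fun n => iter n h b) ->
  exists D, forall n m, (D <= n)%N -> iter n h a = iter m h b ->
    (n <= m + D)%N && (m <= n + D)%N.
Proof.
move=> inj_b; have [[[i l] hil]|no_meet] :=
  pselect (exists il : nat * nat, iter il.1 h a = iter il.2 h b).
  exists (i + l)%N => n m le_n hnm; rewrite /= in hil.
  suff : m = (n - i + l)%N by lia.
  apply: inj_b; rewrite /= -hnm iterD -hil -iterD; congr (iter _ h a); lia.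
by exists 0%N => n m _ hnm; case: no_meet; exists (n, m).
Qed.

Lemma Cantor_bool_seq (f : (nat -> bool) -> nat) : ~ injective f.
Proof.
move=> inj_f.
(* By injectivity, [d (f a)] is the negation of [a (f a)]; taking [a = d] is absurd. *)
pose d n := `[< exists2 a : nat -> bool, f a = n & ~~ a n >].
have [dfd|/negP ndfd] := boolP (d (f d)).
  have /asboolP[a /inj_f ad] := dfd; by rewrite ad dfd.
by apply: (ndfd); apply/asboolP; exists d => //; apply/negP.
Qed.

(** * Iterates of the shift, and the case without a weighted orbit *)

Section WeightedShift.
Variables (R : finFieldType) (Gamma : Type) (phi : Gamma -> Gamma) (w : Gamma -> R).
Local Notation sigma := (weighted_shift phi w).
Local Notation X := (power_space R Gamma).

Lemma iter_weighted_shift (n : nat) (x : X) (a : Gamma) :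
  iter n sigma x a =
  (\prod_(k < n) w (iter k phi a)) * (x (iter n phi a) : R) :> R.
Proof.
elim: n a => [|n IH] a; first by rewrite big_ord0 mul1r.
rewrite iterS /weighted_shift IH big_ord_recl mulrA iterSr.
by congr (_ * _ * _); apply: eq_bigr => k _; rewrite /= -iterSr.
Qed.

Lemma nbhs_power_spaceE (x : X) (U : set X) :
  nbhs x U <-> exists2 H : set Gamma, finite_set H &
    forall y : X, (forall a, H a -> x a = y a) -> U y.
Proof.
split=> [/nbhsP[O /entourage_power_spaceE[H finH HO] OU]|[H finH HU]].
  exists H => // y xy; apply: OU; apply/xsectionP; exact: HO.
apply/nbhsP; exists [set p | forall a, H a -> p.1 a = p.2 a].
  by apply/entourage_power_spaceE; exists H.
by move=> y /xsectionP; apply: HU.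
Qed.

(** Each iterate at [a] either vanishes, its product containing a zero weight, or reads one of the
    first [K] points of the orbit, with [K] independent of [n]. *)
Lemma iter_eq_coordinate (a : Gamma) :
  quasi_periodic phi a \/ (exists n, w (iter n phi a) = 0) ->
  exists2 H : set Gamma, finite_set H &
    forall x y : X, (forall b, H b -> x b = y b) ->
      forall n, iter n sigma x a = iter n sigma y a.
Proof.
move=> a_tame.
have [K hK] : exists K, forall n, \prod_(k < n) w (iter k phi a) = 0 \/
    exists2 k, (k < K)%N & iter n phi a = iter k phi a.
  case: a_tame => [qp|[m wm]].
    by have [K hK] := iter_quasi_periodic qp; exists K => n; right; apply: hK.
  exists m.+1 => n; case: (ltnP m n) => mn; last by right; exists n.
  by left; rewrite (bigD1 (Ordinal mn)) //= wm mul0r.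
exists [set iter k phi a | k in `I_K]; first exact/finite_image/finite_II.
move=> x y xy n; apply: (etrans (iter_weighted_shift n x a)).
apply: (etrans _ (esym (iter_weighted_shift n y a))).
have [->|[k kK ->]] := hK n; first by rewrite !mul0r.
by congr (_ * _); apply: xy; exists k.
Qed.

Definition has_weighted_orbit : Prop :=
  exists theta : Gamma, ~ quasi_periodic phi theta /\
    forall n : nat, w (iter n phi theta) <> 0.

Lemma equicontinuous_no_weighted_orbit (O : set (X * X)) :
  ~ has_weighted_orbit -> entourage O ->
  exists2 O' : set (X * X), entourage O' &
    forall x y, O' (x, y) -> forall n, O (iter n sigma x, iter n sigma y).
Proof.
move=> no_orbit /entourage_power_spaceE[M finM MO].
have tame a : quasi_periodic phi a \/ (exists n, w (iter n phi a) = 0).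
  have [|nqp] := pselect (quasi_periodic phi a); [by left|right].
  apply: contrapT => wn0; apply: no_orbit; exists a; split=> // n wn.
  by apply: wn0; exists n.
have /choice[H HP] a : exists H : set Gamma, finite_set H /\
    forall x y : X, (forall b, H b -> x b = y b) ->
      forall n, iter n sigma x a = iter n sigma y a.
  by have [H] := iter_eq_coordinate (tame a); exists H.
exists [set p | forall b, (\bigcup_(a in M) H a) b -> p.1 b = p.2 b].
  apply/entourage_power_spaceE; exists (\bigcup_(a in M) H a) => //.
  by apply: bigcup_finite => // a _; have [] := HP a.
move=> x y /= xy n; apply: MO => a Ma; apply: (HP a).2 => b Hb.
by apply: xy; exists a.
Qed.

Lemma sensitive_has_weighted_orbit : sensitive sigma -> has_weighted_orbit.
Proof.
move=> [O entO sensO]; apply: contrapT => no_orbit.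
have [O' entO' O'O] := equicontinuous_no_weighted_orbit no_orbit entO.
pose x : X := fun=> 0 : R.
have [oU Ux] := open_nbhs_entourage x entO'.
have [y [n [/interior_subset/xsectionP xy]]] := sensO x _ oU Ux.
by apply; apply: O'O.
Qed.

(** Without such an orbit, equicontinuity turns closeness at a single time [N] into closeness at all
    later times. *)
Lemma scrambled_pair_has_weighted_orbit (x y : X) :
  scrambled_pair sigma x y -> has_weighted_orbit.
Proof.
move=> [prox_xy nasym]; apply: contrapT => no_orbit; apply: nasym => O entO.
have [O' entO' O'O] := equicontinuous_no_weighted_orbit no_orbit entO.
have [N N1 O'N] := prox_xy _ entO'; exists N => // n Nn.
by rewrite -(subnK Nn) !iterD; apply: O'O.
Qed.

(** * Strong sensitivity and chaos from a weighted orbit *)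

Lemma entourage_coordinate (a : Gamma) : entourage [set p : X * X | p.1 a = p.2 a].
Proof.
apply/entourage_power_spaceE; exists [set a]; first exact: finite_set1.
by move=> x y; apply.
Qed.

Lemma iter_weighted_shift_neq (a : Gamma) (x y : X) (n : nat) :
  (forall k, w (iter k phi a) <> 0) ->
  x (iter n phi a) <> y (iter n phi a) ->
  iter n sigma x a <> iter n sigma y a.
Proof.
move=> wn0 xy eq_n; apply: xy.
have := etrans (esym (iter_weighted_shift n x a))
  (etrans eq_n (iter_weighted_shift n y a)).
apply: mulfI; apply/prodf_neq0 => k _; exact/eqP/wn0.
Qed.

Lemma has_weighted_orbit_strongly_sensitive :
  has_weighted_orbit -> strongly_sensitive sigma.
Proof.
move=> [theta [nqp wn0]]; have inj_theta := iter_inj_non_quasi_periodic nqp.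
exists [set p | p.1 theta = p.2 theta]; first exact: entourage_coordinate.
move=> x U oU Ux.
have /nbhs_power_spaceE[H finH HU] : nbhs x U by apply: open_nbhs_nbhs.
(* Agreement on [H] keeps [y] in [U]; off [H] it differs from [x] everywhere, and the injective
   orbit of [theta] leaves [H] for good. *)
pose y : X := fun a => if `[< H a >] then x a else (x a : R) + 1.
have [N hN] : exists N, forall n, H (iter n phi theta) -> (n < N)%N.
  apply: (@finite_set_nat_ltn ((fun n => iter n phi theta) @^-1` H)).
  by apply: finite_preimage => // m n _ _; apply: inj_theta.
exists y, N; split=> [|n Nn].
  by apply: HU => a Ha; rewrite /y asboolT.
apply: iter_weighted_shift_neq => //; rewrite /y asboolF.
  move=> /(congr1 (fun t : R => t - (x (iter n phi theta) : R))) /eqP.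
  by rewrite subrr addrC addKr eq_sym oner_eq0.
by move=> /hN; rewrite ltnNge Nn.
Qed.

(* Each bit [a i] is repeated at all [k] with [logn 2 k = i], so that distinct
   [a] give points differing infinitely often. *)
Definition sparse_point (theta : Gamma) (a : nat -> bool) : X := fun b =>
  if `[< exists2 k, b = iter (2 ^ k) phi theta & a (logn 2 k) >] then 1 : R else 0.

Lemma sparse_pointE (theta : Gamma) (a : nat -> bool) (k : nat) :
  injective (fun n => iter n phi theta) ->
  sparse_point theta a (iter (2 ^ k) phi theta) = (a (logn 2 k))%:R :> R.
Proof.
move=> inj_theta; rewrite /sparse_point; case: asboolP => [[k' /inj_theta/eqP]|nak].
  by rewrite eqn_exp2l // => /eqP -> ->.
by case: (boolP (a _)) => // ak; case: nak; exists k.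
Qed.

Lemma sparse_point_scrambled (theta : Gamma) (a b : nat -> bool) :
  injective (fun n => iter n phi theta) ->
  (forall n, w (iter n phi theta) <> 0) ->
  a <> b -> scrambled_pair sigma (sparse_point theta a) (sparse_point theta b).
Proof.
move=> inj_theta wn0 ab; split.
  move=> O /entourage_power_spaceE[M finM MO].
  have /choice[D DP] c := iter_meet_window c inj_theta.
  have [N hN] := finite_set_nat_ltn (finite_image D finM).
  have N2 : (N < 2 ^ N)%N by apply: ltn_expl.
  (* This time lies at distance [2 ^ N], more than [D c], from both [2 ^ N.+1] and [2 ^ N.+2], so a
     hit would need an exponent strictly between [N.+1] and [N.+2]. *)
  exists (3 * 2 ^ N)%N; first lia.
  apply: MO => c Mc; have DcN : (D c < N)%N by apply: hN; exists c.
  have zero e : sparse_point theta e (iter (3 * 2 ^ N) phi c) = 0 :> R.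
    rewrite /sparse_point asboolF // => -[k hk _].
    have DcN2 : (D c <= 3 * 2 ^ N)%N by lia.
    have /andP[lo hi] := DP c _ _ DcN2 hk.
    have : (2 ^ N.+1 < 2 ^ k)%N by rewrite expnS; lia.
    have : (2 ^ k < 2 ^ N.+2)%N by rewrite !expnS; lia.
    by rewrite !ltn_exp2l //; lia.
  apply: (etrans (iter_weighted_shift _ _ _)).
  apply: (etrans _ (esym (iter_weighted_shift _ _ _))).
  by rewrite !zero.
move=> /(_ _ (entourage_coordinate theta))[N _ asym].
have [i abi] : exists i, a i <> b i by apply/existsNP => /funext.
(* The factor [2 ^ i] selects bit [i]; the odd factor [3 ^ N] makes the time late enough. *)
pose k := (2 ^ i * 3 ^ N)%N.
have log_k : logn 2 k = i.
  by rewrite lognM ?expn_gt0 // pfactorK // lognX -[logn 2 3]/0%N muln0 addn0.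
have Nk : (N <= 2 ^ k)%N.
  apply: (leq_trans (ltnW (@ltn_expl 3 N _))) => //.
  apply: (leq_trans _ (ltnW (@ltn_expl 2 k _))) => //.
  by rewrite leq_pmull // expn_gt0.
have := asym _ Nk; apply: iter_weighted_shift_neq => //.
rewrite !(sparse_pointE _ _ inj_theta) log_k.
by case: (a i) (b i) abi => [] [] //= _ /eqP; rewrite ?oner_eq0 // eq_sym oner_eq0.
Qed.

Lemma has_weighted_orbit_li_yorke_chaotic :
  has_weighted_orbit -> li_yorke_chaotic sigma.
Proof.
move=> [theta [nqp wn0]]; have inj_theta := iter_inj_non_quasi_periodic nqp.
have inj_sparse : injective (sparse_point theta).
  move=> a b ab; apply/funext => i.
  (* The exponent [2 ^ i] has 2-adic valuation [i], so this entry recovers bit [i]. *)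
  have := sparse_pointE a (2 ^ i) inj_theta.
  rewrite ab sparse_pointE // pfactorK //.
  by case: (a i) (b i) => [] [] //= /eqP; rewrite ?oner_eq0 // eq_sym oner_eq0.
exists (range (sparse_point theta)).
  move=> /countable_injP[f inj_f].
  apply: (@Cantor_bool_seq (f \o sparse_point theta)) => a b /inj_f ab.
  by apply: inj_sparse; apply: ab; apply/mem_set; [exists a|exists b].
split.
  exists (sparse_point theta xpredT), (sparse_point theta xpred0); split.
  - by exists xpredT.
  - by exists xpred0.
  - by move=> /inj_sparse/(congr1 (@^~ 0%N)).
move=> _ _ [a _ <-] [b _ <-] ab; apply: sparse_point_scrambled => //.
by move=> eq_ab; apply: ab; rewrite eq_ab.
Qed.

End WeightedShift.

Theorem theorem3p8 (R : finFieldType) (Gamma : Type)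
    (hGamma : exists a b : Gamma, a <> b)
    (phi : Gamma -> Gamma) (w : Gamma -> R) :
  [<-> sensitive (weighted_shift phi w);
       strongly_sensitive (weighted_shift phi w);
       exists theta : Gamma, ~ quasi_periodic phi theta /\
         forall n : nat, w (iter n phi theta) <> 0;
       exists x y : power_space R Gamma,
         scrambled_pair (weighted_shift phi w) x y;
       li_yorke_chaotic (weighted_shift phi w)].
Proof.
have strong_sensitive :
    strongly_sensitive (weighted_shift phi w) -> sensitive (weighted_shift phi w).
  move=> [O entO sensO]; exists O => // x U oU Ux.
  by have [y [N [Uy notO]]] := sensO x U oU Ux; exists y, N; split=> //; apply: notO.
have chaotic_pair : li_yorke_chaotic (weighted_shift phi w) ->
    exists x y, scrambled_pair (weighted_shift phi w) x y.
  by move=> [A _ [[x [y [Ax Ay xy]]] scrA]]; exists x, y; apply: scrA.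
(* Every implication of the cycle is routed through the weighted orbit. *)
tfae.
- by move=> /sensitive_has_weighted_orbit/has_weighted_orbit_strongly_sensitive.
- by move=> /strong_sensitive/sensitive_has_weighted_orbit.
- by move=> /has_weighted_orbit_li_yorke_chaotic/chaotic_pair.
- by move=> [x [y /scrambled_pair_has_weighted_orbit]]
    /has_weighted_orbit_li_yorke_chaotic.
- move=> /chaotic_pair[x [y /scrambled_pair_has_weighted_orbit]].
  by move=> /has_weighted_orbit_strongly_sensitive/strong_sensitive.
Qed.
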